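(* There exist regainingly approximable sets $A,B\subseteq\mathbb{N}$ such that $A\cap B$ is not regainingly approximable.
   Context: A real number $\alpha$ is regainingly approximable if there exists a computable nondecreasing sequence of rational numbers $(a_n)_n$ converging to $\alpha$ such that $\alpha-a_n<2^{-n}$ holds for infinitely many $n\in\mathbb{N}$. For $A\subseteq\mathbb{N}$ let $2^{-A}:=\sum_{a\in A}2^{-(a+1)}$. A set $A\subseteq\mathbb{N}$ is called regainingly approximable if it is computably enumerable and the real number $2^{-A}$ is regainingly approximable. *)

(* Defs.v *)
From mathcomp Require Import all_boot all_order all_algebra.
From mathcomp Require Import all_classical all_reals all_analysis.
Import Order.TTheory GRing.Theory Num.Theory.
Import numFieldNormedType.Exports.

Set Implicit Arguments.
Unset Strict Implicit.
Unset Printing Implicit Defensive.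

(* Kleene's schemes for the partial recursive functions of n arguments. *)
Inductive recfun : nat -> Type :=
| Zero n : recfun n
| Succ : recfun 1
| Proj n (i : 'I_n) : recfun n
| Comp k n (f : recfun k) (g : 'I_k -> recfun n) : recfun n
| Prec n (f : recfun n) (g : recfun n.+2) : recfun n.+1
| Mini n (f : recfun n.+1) : recfun n.

(* computes c xs y: the partial function c is defined at xs, with value y.
   In Prec, h is the trace of the recursion h 0 = f(xs),
   h (k+1) = g(k, h k, xs); only its values up to the recursion argument
   matter. In Mini, f must be defined, and nonzero, at all k < y. *)
Fixpoint computes n (c : recfun n) : n.-tuple nat -> nat -> Prop :=
  match c in recfun n return n.-tuple nat -> nat -> Prop with
  | Zero _ => fun _ y => y = 0%N
  | Succ => fun xs y => y = (thead xs).+1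
  | Proj _ i => fun xs y => y = tnth xs i
  | Comp k _ f g => fun xs y => exists ys : k.-tuple nat,
      (forall i, computes (g i) xs (tnth ys i)) /\ computes f ys y
  | Prec n f g => fun xs y => exists h : nat -> nat,
      [/\ computes f [tuple of behead xs] (h 0%N),
          forall k, (k < thead xs)%N ->
            computes g [tuple of k :: h k :: behead xs] (h k.+1)
        & y = h (thead xs)]
  | Mini _ f => fun xs y =>
      computes f [tuple of y :: xs] 0%N /\
      (forall k, (k < y)%N ->
         exists v, computes f [tuple of k :: xs] v.+1)
  end.

Definition computable (f : nat -> nat) : Prop :=
  exists c : recfun 1, forall n, computes c [tuple n] (f n).

Local Open Scope classical_set_scope.
Local Open Scope ring_scope.

Definition computably_enumerable (A : set nat) : Prop :=
  exists c : recfun 1, A = [set n | exists y, computes c [tuple n] y].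

Definition computable_rat_seq (a : nat -> rat) : Prop :=
  exists s p q : nat -> nat,
    [/\ computable s, computable p, computable q &
        forall n, q n != 0%N /\ a n = (-1) ^+ s n * (p n)%:R / (q n)%:R].

Section Regaining.
Variable R : realType.

Definition regainingly_approximable (alpha : R) : Prop :=
  exists a : nat -> rat,
    [/\ computable_rat_seq a,
        {homo a : m n / (m <= n)%N >-> m <= n},
        (fun n => ratr (a n) : R) @ \oo --> alpha
      & infinite_set [set n | alpha - ratr (a n) < 2 ^- n]].

Definition real_of_set (A : set nat) : R :=
  limn (fun n => \sum_(0 <= k < n | k \in A) (2 ^- k.+1 : R)).

Definition regainingly_approximable_set (A : set nat) : Prop :=
  computably_enumerable A /\ regainingly_approximable (real_of_set A).

End Regaining.

Arguments real_of_set R A : clear implicits.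
Arguments regainingly_approximable_set R A : clear implicits.

(* Main.v *)
(**
  Let [phi_e] be the partial function with code [e], and let [C] be the set of
  all [x] such that [phi_(nfst x) x] is defined, where an element enters [C]
  only at a stage exceeding the value of that computation. For computable [h],
  a program for [x |-> h (6 x + 20)] shows that for almost all [n] some [x] with
  [2 x + 4 <= n <= 6 x + 20] enters [C] after stage [h (6 x + 20)].

  A finite-injury argument splits the enumeration of [C] into two halves [C0]
  and [C1], each of which is infinitely often settled below [m] at stage [m].
  Then A = evens + {2x+1 : x in C1} and B = odds + {2x : x in C0} are
  regainingly approximable, while A `&` B = {2x : x in C0} + {2x+1 : x in C1}
  settles no faster than [C]. An approximation regaining the real number of
  A `&` B would yield a computable [h] such that, for infinitely many [n],
  everything in A `&` B up to [n - 3] is present at all stages [h m], [m >= n].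
*)
Require Import Defs.
From mathcomp Require Import all_boot all_order all_algebra.
From mathcomp Require Import all_classical all_reals all_analysis.
From mathcomp Require Import zify lra.
Local Open Scope classical_set_scope.
Set Implicit Arguments.
Unset Strict Implicit.
Unset Printing Implicit Defensive.

(** * Closure properties of the computable functions *)

Definition computable2 (f : nat -> nat -> nat) : Prop :=
  exists c : recfun 2, forall x y, computes c [tuple x; y] (f x y).

Definition computable3 (f : nat -> nat -> nat -> nat) : Prop :=
  exists c : recfun 3, forall x y z, computes c [tuple x; y; z] (f x y z).

Definition comp1 n (f : recfun 1) (g : recfun n) : recfun n :=
  Comp f (fun=> g).

Definition comp2 n (f : recfun 2) (g h : recfun n) : recfun n :=
  Comp f (fun i : 'I_2 => if i == 0 :> nat then g else h).

Lemma computes_comp1 n f (g : recfun n) xs a y :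
  computes g xs a -> computes f [tuple a] y -> computes (comp1 f g) xs y.
Proof.
move=> ga fy; exists [tuple a]; split=> // i.
by rewrite ord1.
Qed.

Lemma computes_comp2 n f (g h : recfun n) xs a b y :
  computes g xs a -> computes h xs b -> computes f [tuple a; b] y ->
  computes (comp2 f g h) xs y.
Proof.
move=> ga hb fy; exists [tuple a; b]; split=> //.
by case=> -[|[|//]] i.
Qed.

Lemma computes_prec f g (f0 : nat -> nat) (g0 : nat -> nat -> nat -> nat) n x :
  (forall x, computes f [tuple x] (f0 x)) ->
  (forall k a x, computes g [tuple k; a; x] (g0 k a x)) ->
  computes (Prec f g) [tuple n; x]
    (nat_rect (fun=> nat) (f0 x) (fun k a => g0 k a x) n).
Proof.
move=> fP gP; exists (nat_rect (fun=> nat) (f0 x) (fun k a => g0 k a x)).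
split=> //= [|k _].
  by rewrite (_ : [tuple of _] = [tuple x]); [exact: fP|exact: val_inj].
rewrite (_ : [tuple of _] = [tuple k; nat_rect (fun=> nat) (f0 x)
  (fun k a => g0 k a x) k; x]); [exact: gP|exact: val_inj].
Qed.

Lemma computes_mini (P : nat -> nat -> bool) (c : recfun 2) x y :
  (forall y x, computes c [tuple y; x] (~~ P y x)) ->
  P y x -> (forall k, k < y -> ~~ P k x) -> computes (Mini c) [tuple x] y.
Proof.
move=> cP Py Pk; split=> [|k /Pk Pkx].
  rewrite (_ : [tuple of _] = [tuple y; x]); last exact: val_inj.
  by have := cP y x; rewrite Py.
exists 0; rewrite (_ : [tuple of _] = [tuple k; x]); last exact: val_inj.
by have := cP k x; rewrite Pkx.
Qed.

Lemma computes_inj n (c : recfun n) xs y z :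
  computes c xs y -> computes c xs z -> y = z.
Proof.
elim: c xs y z => {n} [n||n i|k n f IHf g IHg|n f IHf g IHg|n f IHf] xs y z /=.
- by move=> -> ->.
- by move=> -> ->.
- by move=> -> ->.
- move=> [ys [gys fy]] [zs [gzs fz]].
  suff E : ys = zs by apply: IHf fy _; rewrite E.
  by apply: eq_from_tnth => i; apply: IHg (gys i) (gzs i).
- move=> [h [f0 gh ->]] [h' [f0' gh' ->]].
  suff E k : k <= thead xs -> h k = h' k by exact: E.
  elim: k => [_|k IHk kx]; first exact: IHf f0 f0'.
  by apply: IHg (gh _ kx) _; rewrite IHk ?(ltnW kx)//; exact: gh'.
- move=> [fy fly] [fz flz].
  have [yz|zy|//] := ltngtP y z.
    by have [v fv] := flz _ yz; have := IHf _ _ _ fy fv.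
  by have [v fv] := fly _ zy; have := IHf _ _ _ fz fv.
Qed.

Lemma computable_ext f g : computable f -> f =1 g -> computable g.
Proof. by move=> [c cP] fg; exists c => n; rewrite -fg. Qed.

Lemma computable_id : computable (fun x => x).
Proof. by exists (@Proj 1 ord0). Qed.

Lemma computable_comp f g :
  computable f -> computable g -> computable (fun x => f (g x)).
Proof.
by move=> [c cP] [d dP]; exists (comp1 c d) => x; apply: computes_comp1.
Qed.

Lemma computable_comp2 f g h : computable2 f -> computable g -> computable h ->
  computable (fun x => f (g x) (h x)).
Proof.
move=> [c cP] [d dP] [e eP]; exists (comp2 c d e) => x.
exact: computes_comp2 (cP _ _).
Qed.

Lemma computable_succ f : computable f -> computable (fun x => (f x).+1).
Proof. by move=> fP; apply: computable_comp fP; exists Succ. Qed.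

Lemma computable_const k : computable (fun=> k).
Proof. by elim: k => [|k]; [exists (@Zero 1)|exact: computable_succ]. Qed.

Definition proj20 : recfun 2 := @Proj 2 ord0.
Definition proj21 : recfun 2 := @Proj 2 (lift ord0 ord0).
Definition proj30 : recfun 3 := @Proj 3 ord0.
Definition proj31 : recfun 3 := @Proj 3 (lift ord0 ord0).
Definition proj32 : recfun 3 := @Proj 3 (lift ord0 (lift ord0 ord0)).

Lemma computable2_prec f g : computable f -> computable3 g ->
  computable2 (fun n x => nat_rect (fun=> nat) (f x) (fun k a => g k a x) n).
Proof.
by move=> [c cP] [d dP]; exists (Prec c d) => n x; apply: computes_prec.
Qed.

Lemma computable2_add : computable2 addn.
Proof.
have [c cP] : computable2
    (fun n x => nat_rect (fun=> nat) x (fun k a => a.+1) n).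
  apply: (@computable2_prec (fun x => x) (fun _ a _ => a.+1)).
    exact: computable_id.
  by exists (comp1 Succ proj31) => x y z; apply: computes_comp1.
by exists c => x y; have := cP x y; congr computes; elim: x => //= x ->.
Qed.

Lemma computable2_mul : computable2 muln.
Proof.
have [d dP] := computable2_add.
have [c cP] : computable2
    (fun n x => nat_rect (fun=> nat) 0 (fun k a => x + a) n).
  apply: (@computable2_prec (fun x => 0) (fun _ a x => x + a)).
    exact: computable_const.
  by exists (comp2 d proj32 proj31) => x y z; apply: computes_comp2 (dP _ _).
exists c => x y; have := cP x y; congr computes.
by elim: x => //= x ->; rewrite mulSn.
Qed.

Lemma computable2_pred : computable2 (fun n _ => n.-1).
Proof.
have [c cP] : computable2
    (fun n x => nat_rect (fun=> nat) 0 (fun k a => k) n).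
  apply: (@computable2_prec (fun x => 0) (fun k a x => k)).
    exact: computable_const.
  by exists proj30 => x y z.
by exists c => x y; have := cP x y; congr computes; case: x.
Qed.

Lemma computable2_sub : computable2 subn.
Proof.
have [d dP] := computable2_pred.
have [c cP] : computable2
    (fun n x => nat_rect (fun=> nat) x (fun k a => a.-1) n).
  apply: (@computable2_prec (fun x => x) (fun k a x => a.-1)).
    exact: computable_id.
  by exists (comp2 d proj31 proj31) => x y z; apply: computes_comp2 (dP _ y).
exists (comp2 c proj21 proj20) => x y.
apply: computes_comp2 => //.
have := cP y x; congr computes.
by elim: y => [|y /= ->]; rewrite ?subn0// subnS.
Qed.

Lemma computable_add f g : computable f -> computable g ->
  computable (fun x => f x + g x).
Proof. exact/computable_comp2/computable2_add. Qed.

Lemma computable_mul f g : computable f -> computable g ->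
  computable (fun x => f x * g x).
Proof. exact/computable_comp2/computable2_mul. Qed.

Lemma computable_sub f g : computable f -> computable g ->
  computable (fun x => f x - g x).
Proof. exact/computable_comp2/computable2_sub. Qed.

Lemma computable_pred f : computable f -> computable (fun x => (f x).-1).
Proof.
move=> fP; apply: (computable_ext (computable_sub fP (computable_const 1))).
by move=> x; rewrite subn1.
Qed.

Definition computable_bool (P : nat -> bool) : Prop :=
  computable (fun x => P x).

Lemma computable_leq f g : computable f -> computable g ->
  computable_bool (fun x => f x <= g x).
Proof.
move=> fP gP.
apply: (computable_ext (computable_sub (computable_const 1)
  (computable_sub fP gP))) => x.
by rewrite /leq; case: (f x - g x) => // n; rewrite subSS sub0n.
Qed.

Lemma computable_neg P : computable_bool P -> computable_bool (fun x => ~~ P x).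
Proof.
move=> cP; apply: (computable_ext (computable_sub (computable_const 1) cP)) => x.
by case: (P x).
Qed.

Lemma computable_and P Q : computable_bool P -> computable_bool Q ->
  computable_bool (fun x => P x && Q x).
Proof.
move=> cP cQ; apply: (computable_ext (computable_mul cP cQ)) => x.
by case: (P x); case: (Q x).
Qed.

Lemma computable_or P Q : computable_bool P -> computable_bool Q ->
  computable_bool (fun x => P x || Q x).
Proof.
move=> cP cQ; apply: (computable_ext (computable_neg (computable_and
  (computable_neg cP) (computable_neg cQ)))) => x.
by rewrite negb_and !negbK.
Qed.

Lemma computable_imply P Q : computable_bool P -> computable_bool Q ->
  computable_bool (fun x => P x ==> Q x).
Proof.
move=> cP cQ; apply: (computable_ext (computable_or (computable_neg cP) cQ)) => x.
by rewrite implybE.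
Qed.

Lemma computable_eq f g : computable f -> computable g ->
  computable_bool (fun x => f x == g x).
Proof.
move=> fP gP.
apply: (computable_ext (computable_and (computable_leq fP gP)
  (computable_leq gP fP))) => x.
by rewrite eqn_leq.
Qed.

Lemma computable_if P f g : computable_bool P -> computable f -> computable g ->
  computable (fun x => if P x then f x else g x).
Proof.
move=> cP cf cg.
apply: (computable_ext (computable_add (computable_mul cP cf)
  (computable_mul (computable_neg cP) cg))) => x.
by case: (P x); rewrite /= ?mul1n ?mul0n ?addn0.
Qed.

Lemma computable2_comp2 f g h : computable2 f -> computable2 g ->
  computable2 h -> computable2 (fun x y => f (g x y) (h x y)).
Proof.
move=> [c cP] [d dP] [e eP]; exists (comp2 c d e) => x y.
exact: computes_comp2 (cP _ _).
Qed.

(** * Integer square roots and pairing *)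

Definition nsqrt n := find (fun r => n < r.+1 * r.+1) (iota 0 n.+1).

Lemma nsqrtP n : nsqrt n * nsqrt n <= n < (nsqrt n).+1 * (nsqrt n).+1.
Proof.
have hn : has (fun r => n < r.+1 * r.+1) (iota 0 n.+1).
  by apply/hasP; exists n; rewrite ?mem_iota//; nia.
have lt_n : nsqrt n < n.+1 by move: hn; rewrite has_find size_iota.
have := nth_find 0 hn; rewrite nth_iota// add0n => ->; rewrite andbT.
case E : (nsqrt n) => [//|r].
have := @before_find _ 0 (fun r => n < r.+1 * r.+1) (iota 0 n.+1) r.
by rewrite -/(nsqrt n) E nth_iota; [move=> /(_ (leqnn _)); lia|lia].
Qed.

Lemma nsqrt_uniq n r : r * r <= n < r.+1 * r.+1 -> nsqrt n = r.
Proof. by have := nsqrtP n; nia. Qed.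

(** Minimisation is carried out by hand here: the general search lemma rests on pairing, and pairing
    on this square root. *)
Lemma computable_nsqrt f : computable f -> computable (fun x => nsqrt (f x)).
Proof.
apply: computable_comp.
pose P r n := n < r.+1 * r.+1.
have [c cP] : computable2 (fun r n => ~~ P r n).
  have c1 : computable2 (fun r n => r.+1).
    by exists (comp1 Succ proj20) => x y; apply: computes_comp1.
  have cx : computable2 (fun r n => n) by exists proj21.
  have c0 : computable2 (fun r n => 1).
    by exists (comp1 Succ (Zero 2)) => x y; exact: (@computes_comp1 _ _ _ _ 0).
  have [c cP] := computable2_comp2 computable2_sub c0 (computable2_comp2
    computable2_sub (computable2_comp2 computable2_mul c1 c1) cx).
  exists c => x y; have := cP x y; congr computes.
  by rewrite /P -leqNgt /leq; case: (_ - y) => // n; rewrite subSS sub0n.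
exists (Mini c) => n; apply: (computes_mini cP).
  by rewrite /P; case/andP: (nsqrtP n).
by move=> k kn; rewrite /P; have := nsqrtP n; nia.
Qed.

(* Not onto: [n] is a pair only if [npair (nfst n) (nsnd n) = n]. *)
Definition npair a b := (a + b) * (a + b) + a.
Definition nfst n := n - nsqrt n * nsqrt n.
Definition nsnd n := nsqrt n - nfst n.

Lemma nsqrt_npair a b : nsqrt (npair a b) = a + b.
Proof. by apply: nsqrt_uniq; rewrite /npair; nia. Qed.

Lemma nfst_npair a b : nfst (npair a b) = a.
Proof. by rewrite /nfst nsqrt_npair /npair addKn. Qed.

Lemma nsnd_npair a b : nsnd (npair a b) = b.
Proof. by rewrite /nsnd nfst_npair nsqrt_npair addKn. Qed.

Definition npairK := (nfst_npair, nsnd_npair).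

Lemma leq_npairr a b : b <= npair a b.
Proof. by rewrite /npair; nia. Qed.

Lemma nfst_leq n : nfst n <= n.
Proof. by rewrite /nfst leq_subr. Qed.

Lemma nsnd_leq n : nsnd n <= n.
Proof. by rewrite /nsnd; have := nsqrtP n; nia. Qed.

Lemma computable_npair f g : computable f -> computable g ->
  computable (fun x => npair (f x) (g x)).
Proof.
move=> cf cg; have cfg := computable_add cf cg.
exact: computable_add (computable_mul cfg cfg) cf.
Qed.

Lemma computable_nfst f : computable f -> computable (fun x => nfst (f x)).
Proof.
move=> cf; have cs := computable_nsqrt cf.
exact: computable_sub cf (computable_mul cs cs).
Qed.

Lemma computable_nsnd f : computable f -> computable (fun x => nsnd (f x)).
Proof.
by move=> cf; exact: computable_sub (computable_nsqrt cf) (computable_nfst cf).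
Qed.

(** Brings binary functions within reach of the unary closure lemmas: a unary program for
    [f (nfst w) (nsnd w)] is run at [w = npair x y]. *)
Lemma computable2P (f : nat -> nat -> nat) :
  (forall g h, computable g -> computable h ->
     computable (fun w => f (g w) (h w))) -> computable2 f.
Proof.
move=> cf; have [c cP] := cf _ _ (computable_nfst computable_id)
  (computable_nsnd computable_id).
have [p pP] : computable2 npair.
  have [d dP] := computable2_mul; have [e eP] := computable2_add.
  exists (comp2 e (comp2 d e e) proj20) => x y.
  apply: computes_comp2 (eP _ _) => //.
  exact: computes_comp2 (dP _ _).
exists (comp1 c p) => x y.
by apply: computes_comp1 (pP _ _) _; have := cP (npair x y); rewrite !npairK.
Qed.

Lemma computable3P (f : nat -> nat -> nat -> nat) :
  (forall g h k, computable g -> computable h -> computable k ->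
     computable (fun w => f (g w) (h w) (k w))) -> computable3 f.
Proof.
move=> cf; have c1 := computable_nsnd computable_id.
have [c cP] := cf _ _ _ (computable_nfst computable_id)
  (computable_nfst c1) (computable_nsnd c1).
have [p pP] : computable2 npair.
  by apply: computable2P => g h; apply: computable_npair.
exists (comp1 c (comp2 p proj30 (comp2 p proj31 proj32))) => x y z.
apply: (@computes_comp1 _ _ _ _ (npair x (npair y z))).
  by apply: computes_comp2 (pP _ _) => //; apply: computes_comp2 (pP _ _).
by have := cP (npair x (npair y z)); rewrite !npairK.
Qed.

(** The parameter of the primitive recursion is [w] itself, so base case, step and length may all
    depend on it. *)
Lemma computable_rec (f n : nat -> nat) (g : nat -> nat -> nat -> nat) :
  computable f -> computable n ->
  (forall k a x, computable k -> computable a -> computable x ->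
     computable (fun w => g (k w) (a w) (x w))) ->
  computable (fun w => nat_rect (fun=> nat) (f w) (fun k a => g k a w) (n w)).
Proof.
move=> cf cn /computable3P cg.
exact: (computable_comp2 (computable2_prec cf cg) cn computable_id).
Qed.

Lemma computable_search (P : nat -> nat -> bool) :
  (forall y x, computable y -> computable x ->
     computable_bool (fun w => P (y w) (x w))) ->
  (forall x, exists y, P y x) ->
  exists2 h, computable h & forall x, P (h x) x /\ forall k, k < h x -> ~~ P k x.
Proof.
move=> cP exP.
have [c cc] : computable2 (fun y x => ~~ P y x).
  by apply: computable2P => g h cg ch; apply/computable_neg/cP.
exists (fun x => ex_minn (exP x)).
  exists (Mini c) => x; apply: (computes_mini cc); case: ex_minnP => // m _ mP k.
  by apply: contraL => /mP; rewrite leqNgt.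
move=> x; case: ex_minnP => m Pm mP; split=> // k.
by apply: contraL => /mP; rewrite leqNgt.
Qed.

(** The set is the domain of the unbounded search for [y]. Conversely, a value returned by the
    search makes the test program give 0, which by [computes_inj] forces [P]. *)
Lemma ce_ex (P : nat -> nat -> bool) :
  (forall y x, computable y -> computable x ->
     computable_bool (fun w => P (y w) (x w))) ->
  computably_enumerable [set x | exists y, P y x]%classic.
Proof.
move=> cP; have [c cc] : computable2 (fun y x => ~~ P y x).
  by apply: computable2P => g h cg ch; apply/computable_neg/cP.
exists (Mini c); apply/seteqP; split=> x /=.
  move=> exP; exists (ex_minn exP); apply: (computes_mini cc).
    by case: ex_minnP.
  move=> k; case: ex_minnP => m _ mP.
  by apply: contraL => /mP; rewrite leqNgt.
move=> [y [+ _]]; rewrite (_ : [tuple of _] = [tuple y; x]); last exact: val_inj.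
move=> cy; exists y; apply: contraT => nP.
by have := computes_inj cy (cc y x); rewrite nP.
Qed.

Lemma computable_all (P : nat -> nat -> bool) (n : nat -> nat) :
  (forall y x, computable y -> computable x ->
     computable_bool (fun w => P (y w) (x w))) ->
  computable n ->
  computable_bool (fun w => all (fun k => P k w) (iota 0 (n w))).
Proof.
move=> cP cn.
pose g k a x := (P k x : nat) * a.
apply: (@computable_ext (fun w =>
    nat_rect (fun=> nat) 1 (fun k a => g k a w) (n w))).
  apply: computable_rec => //; first exact: computable_const.
  by move=> k a x *; apply: computable_mul => //; exact: cP.
move=> x; elim: (n x) => // m IHm.
have -> : iota 0 m.+1 = rcons (iota 0 m) m by rewrite -cats1 -[m.+1]addn1 iotaD.
by rewrite all_rcons /= IHm /g mulnb.
Qed.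

Lemma computable_has (P : nat -> nat -> bool) (n : nat -> nat) :
  (forall y x, computable y -> computable x ->
     computable_bool (fun w => P (y w) (x w))) ->
  computable n ->
  computable_bool (fun w => has (fun k => P k w) (iota 0 (n w))).
Proof.
move=> cP cn.
have cN := @computable_all (fun k w => ~~ P k w) n.
apply: (computable_ext (computable_neg (cN _ cn))).
  by move=> y x cy cx; apply: computable_neg; exact: cP.
move=> x /=; rewrite -has_predC; congr nat_of_bool.
by apply: eq_has => k; rewrite /= negbK.
Qed.

Lemma computable_sum (f : nat -> nat -> nat) (n : nat -> nat) :
  (forall y x, computable y -> computable x ->
     computable (fun w => f (y w) (x w))) ->
  computable n ->
  computable (fun w => \sum_(k < n w) f k w).
Proof.
move=> cf cn; apply: (@computable_ext (fun w =>
    nat_rect (fun=> nat) 0 (fun k a => a + f k w) (n w))).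
  apply: (@computable_rec _ _ (fun k a w => a + f k w)) => //.
    exact: computable_const.
  by move=> k a x *; apply: computable_add => //; exact: cf.
by move=> x; elim: (n x) => [|m /= ->]; rewrite ?big_ord0// big_ord_recr.
Qed.

Lemma computable_exp2 f : computable f -> computable (fun x => 2 ^ f x).
Proof.
move=> cf; apply: (@computable_ext (fun w =>
    nat_rect (fun=> nat) 1 (fun k a => a + a) (f w))).
  apply: (@computable_rec _ _ (fun k a w => a + a)) => //.
    exact: computable_const.
  by move=> k a x *; apply: computable_add.
by move=> x; elim: (f x) => //= m ->; rewrite expnS mul2n addnn.
Qed.

Lemma computable_div f g : computable f -> computable g ->
  computable (fun x => f x %/ g x).
Proof.
(* The quotient counts the positive multiples of the divisor up to the dividend. The guard [0 < d]
   gives 0 for division by zero, in agreement with [%/]. *)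
move=> cf cg; pose P k d m := (0 < d) && (k.+1 * d <= m).
apply: (@computable_ext (fun w => \sum_(k < f w) P k (g w) (f w))).
  apply: (@computable_sum (fun k w => P k (g w) (f w))) => // y x cy cx.
  have cgx := computable_comp cg cx; have cfx := computable_comp cf cx.
  apply: computable_and; apply: computable_leq => //.
    exact: computable_const.
  by apply: computable_mul => //; apply: computable_succ.
move=> x; rewrite /P; case: (posnP (g x)) => [->|g0]; first by rewrite divn0 big1.
under eq_bigr do rewrite /= -leq_divRL//.
rewrite -(big_mkord xpredT (fun k => (k < f x %/ g x) : nat)).
rewrite (big_cat_nat (n := f x %/ g x)) ?leq_div//=.
rewrite (eq_big_nat _ _ (F2 := fun=> 1)); last by move=> i /andP[_ ->].
rewrite sum_nat_const_nat muln1 subn0 big_nat big1 ?addn0// => i /andP[].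
by rewrite leqNgt => /negbTE ->.
Qed.

Lemma computable_odd f : computable f -> computable_bool (fun x => odd (f x)).
Proof.
move=> cf; have c2 : computable (fun=> 2) by exact: computable_const.
apply: (computable_ext (computable_sub cf (computable_mul
  (computable_div cf c2) c2))) => x.
by rewrite {1}(divn_eq (f x) 2) addKn modn2.
Qed.

(** True by conversion, but constants are opaque to the hint database, so automation has to be given
    this passage as a lemma. *)
Lemma computable_bool_nat P :
  computable_bool P -> computable (fun x => nat_of_bool (P x)).
Proof. by []. Qed.

Lemma computable_bool_if P Q S : computable_bool P -> computable_bool Q ->
  computable_bool S -> computable_bool (fun x => if P x then Q x else S x).
Proof.
move=> cP cQ cS; apply: (computable_ext (computable_if cP cQ cS)) => x.
by case: (P x).
Qed.

Create HintDb comp discriminated.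
#[global] Hint Constants Opaque : comp.
#[global] Hint Resolve computable_id computable_const computable_succ
  computable_add computable_mul computable_sub computable_pred computable_leq
  computable_neg computable_and computable_or computable_imply computable_eq
  computable_if computable_bool_if computable_nsqrt computable_npair
  computable_nfst computable_nsnd computable_all computable_has
  computable_sum computable_exp2 computable_div computable_odd
  computable_bool_nat : comp.

(** Composition with a hypothesis [computable f]. Restricting [f] to variables keeps the
    second-order pattern from splitting terms that the closure lemmas handle. *)
Ltac computable_var :=
  match goal with |- computable (fun w => ?f (@?g w)) =>
    is_var f; refine (@computable_comp f g _ _) end.
#[global] Hint Extern 5 (computable _) => computable_var : comp.

Ltac computability := auto 60 with comp nocore.

(** * A universal program: finite derivations coded by numbers *)

(** The number [d] stands for the finite set of the positions of its binary digits 1. *)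
Definition bit d t := odd (d %/ 2 ^ t).

Lemma computable_bit f g : computable f -> computable g ->
  computable_bool (fun x => bit (f x) (g x)).
Proof. by move=> cf cg; rewrite /bit; computability. Qed.
#[global] Hint Resolve computable_bit : comp.

Lemma bit_ltn d t : bit d t -> t < d.
Proof.
move=> b; apply: (@leq_trans (2 ^ t)); first exact: ltn_expl.
by move: b; rewrite /bit leqNgt; apply: contraL => /divn_small ->.
Qed.

Definition bitmask n (P : nat -> bool) := \sum_(t < n) P t * 2 ^ t.

Lemma bitmask_ltn n P : bitmask n P < 2 ^ n.
Proof.
elim: n => [|n IHn]; first by rewrite /bitmask big_ord0.
rewrite /bitmask big_ord_recr /= -/(bitmask n P) expnS mul2n -addnn.
by rewrite -addSn leq_add//; case: (P n); rewrite ?mul1n ?mul0n.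
Qed.

Lemma bit_bitmask n P t : bit (bitmask n P) t = (t < n) && P t.
Proof.
elim: n => [|n IHn]; first by rewrite /bitmask big_ord0 /bit div0n.
rewrite /bitmask big_ord_recr /= -/(bitmask n P) /bit ltnS.
have [tn|nt|->] := ltngtP t n.
- rewrite divnDr; last by rewrite dvdn_mull// dvdn_exp2l// ltnW.
  rewrite oddD -/(bit _ _) IHn tn /=.
  rewrite -muln_divA ?dvdn_exp2l ?(ltnW tn)// -expnB ?(ltnW tn)//.
  by rewrite oddM oddX subn_eq0 leqNgt tn andbF addbF.
- rewrite divn_small//.
  apply: leq_trans (_ : 2 ^ n.+1 <= _); last by rewrite leq_exp2l.
  have := bitmask_ltn n.+1 P; by rewrite /bitmask big_ord_recr.
- rewrite addnC divnMDl ?expn_gt0// divn_small ?bitmask_ltn// addn0.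
  by case: (P n).
Qed.

Lemma computable_bitmask (n : nat -> nat) (P : nat -> nat -> bool) :
  computable n ->
  (forall y x, computable y -> computable x ->
     computable_bool (fun w => P (y w) (x w))) ->
  computable (fun w => bitmask (n w) (fun t => P t w)).
Proof.
move=> cn cP; rewrite /bitmask.
apply: (@computable_sum (fun t w => P t w * 2 ^ t)) => // y x cy cx.
by have := cP _ _ cy cx; computability.
Qed.
#[global] Hint Resolve computable_bitmask : comp.

Definition mem3 d c x y := bit d (npair c (npair x y)).

Lemma computable_mem3 d c x y :
  computable d -> computable c -> computable x -> computable y ->
  computable_bool (fun w => mem3 (d w) (c w) (x w) (y w)).
Proof. by move=> *; rewrite /mem3; computability. Qed.
#[global] Hint Resolve computable_mem3 : comp.

(** Makes the searches over [iota 0 d] in [justified] exhaustive: every output recorded in [d] is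
    smaller than [d]. *)
Lemma mem3_ltn d c x y : mem3 d c x y -> y < d.
Proof.
move=> /bit_ltn; apply: leq_trans; rewrite ltnS.
by apply: leq_trans (leq_npairr _ _) (leq_npairr _ _).
Qed.

(** Coded programs act on single numbers. Argument lists are packed by [npair], so pairing and its
    two projections are instructions, replacing the projections and the many-argument composition of
    [recfun]. *)
Definition czero := npair 0 0.
Definition csucc := npair 1 0.
Definition cfst := npair 2 0.
Definition csnd := npair 3 0.
Definition cpair a b := npair 4 (npair a b).
Definition ccomp a b := npair 5 (npair a b).
Definition cprec a b := npair 6 (npair a b).
Definition cmini a := npair 7 (npair a 0).

(* [d] codes the set of the triples [(c, x, y)] with [mem3 d c x y], read as
   "program [c] maps [x] to [y]". Circular justifications do no harm: a triple is
   justified by triples about smaller programs, or about the same program and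
   a smaller recursion argument. *)
Definition justified d c x y :=
  let tag := nfst c in let a := nfst (nsnd c) in let b := nsnd (nsnd c) in
  [|| (tag == 0) && (y == 0),
      (tag == 1) && (y == x.+1),
      (tag == 2) && (y == nfst x),
      (tag == 3) && (y == nsnd x),
      (tag == 4) && [&& y == npair (nfst y) (nsnd y), mem3 d a x (nfst y)
                      & mem3 d b x (nsnd y)],
      (tag == 5) && has (fun z => mem3 d b x z && mem3 d a z y) (iota 0 d),
      (tag == 6) && (if nfst x == 0 then mem3 d a (nsnd x) y else
        has (fun z => mem3 d c (npair (nfst x).-1 (nsnd x)) z &&
          mem3 d b (npair (nfst x).-1 (npair z (nsnd x))) y) (iota 0 d))
    | (tag == 7) && (mem3 d a (npair y x) 0 &&
        all (fun k => has (fun v => mem3 d a (npair k x) v.+1) (iota 0 d))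
          (iota 0 y))].

Definition derivation d :=
  all (fun t => bit d t ==> justified d (nfst t) (nfst (nsnd t)) (nsnd (nsnd t)))
    (iota 0 d).

Lemma computable_justified d c x y :
  computable d -> computable c -> computable x -> computable y ->
  computable_bool (fun w => justified (d w) (c w) (x w) (y w)).
Proof.
by move=> cd cc cx cy; rewrite /justified; computability.
Qed.
#[global] Hint Resolve computable_justified : comp.

Lemma computable_derivation d :
  computable d -> computable_bool (fun w => derivation (d w)).
Proof.
by move=> cd; rewrite /derivation; computability.
Qed.
#[global] Hint Resolve computable_derivation : comp.

Lemma derivationP d c x y : derivation d -> mem3 d c x y -> justified d c x y.
Proof.
move=> /allP chd m; have := chd (npair c (npair x y)).
rewrite mem_iota /= add0n (bit_ltn m) => /(_ isT).
by move: m; rewrite /mem3 => ->; rewrite !npairK.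
Qed.

Lemma justified_zero d x y : justified d czero x y = (y == 0).
Proof. by rewrite /justified !npairK /= orbF. Qed.

Lemma justified_succ d x y : justified d csucc x y = (y == x.+1).
Proof. by rewrite /justified !npairK /= orbF. Qed.

Lemma justified_fst d x y : justified d cfst x y = (y == nfst x).
Proof. by rewrite /justified !npairK /= orbF. Qed.

Lemma justified_snd d x y : justified d csnd x y = (y == nsnd x).
Proof. by rewrite /justified !npairK /= orbF. Qed.

Lemma justified_pair d a b x y : justified d (cpair a b) x y =
  [&& y == npair (nfst y) (nsnd y), mem3 d a x (nfst y) & mem3 d b x (nsnd y)].
Proof. by rewrite /justified !npairK /= orbF. Qed.

Lemma justified_comp d a b x y : justified d (ccomp a b) x y =
  has (fun z => mem3 d b x z && mem3 d a z y) (iota 0 d).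
Proof. by rewrite /justified !npairK /= orbF. Qed.

Lemma justified_prec0 d a b x y : justified d (cprec a b) (npair 0 x) y =
  mem3 d a x y.
Proof. by rewrite /justified !npairK /= orbF. Qed.

Lemma justified_precS d a b k x y : justified d (cprec a b) (npair k.+1 x) y =
  has (fun z => mem3 d (cprec a b) (npair k x) z &&
    mem3 d b (npair k (npair z x)) y) (iota 0 d).
Proof. by rewrite /justified !npairK /= orbF. Qed.

Lemma justified_mini d a x y : justified d (cmini a) x y =
  mem3 d a (npair y x) 0 &&
  all (fun k => has (fun v => mem3 d a (npair k x) v.+1) (iota 0 d))
    (iota 0 y).
Proof. by rewrite /justified !npairK. Qed.

Definition justifiedE := (justified_zero, justified_succ, justified_fst,
  justified_snd, justified_pair, justified_comp,
  justified_prec0, justified_precS, justified_mini).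

Lemma has_iotaP n (P : nat -> bool) :
  reflect (exists2 z, z < n & P z) (has P (iota 0 n)).
Proof.
apply: (iffP hasP) => -[z zn Pz]; exists z => //.
  by move: zn; rewrite mem_iota.
by rewrite mem_iota.
Qed.

Lemma all_iotaP n (P : nat -> bool) :
  reflect (forall z, z < n -> P z) (all P (iota 0 n)).
Proof.
apply: (iffP allP) => nP z zn; apply: nP; first by rewrite mem_iota.
by move: zn; rewrite mem_iota.
Qed.

(** [mem3] occurs only positively in [justified], and a witness found in the larger set lies below
    its bound by [mem3_ltn]. This monotonicity lets derivations be extended and merged. *)
Lemma sub_justified d d' c x y :
  (forall t, bit d t -> bit d' t) -> justified d c x y -> justified d' c x y.
Proof.
move=> dd'; have sm a b z : mem3 d a b z -> mem3 d' a b z by move/dd'.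
rewrite /justified => /orP[->//|].
do 3 ![move=> /orP[->|]; first by rewrite ?orbT].
move=> /or4P[].
- move=> /andP[-> /and3P[-> /sm-> /sm->]]; by rewrite ?orbT.
- move=> /andP[-> /has_iotaP[z _ /andP[/sm m1 /sm m2]]].
  do 5 ![apply/orP; right]; apply/orP; left; apply/has_iotaP.
  by exists z; [exact: mem3_ltn m1|rewrite m1 m2].
- move=> /andP[-> H]; do 6 ![apply/orP; right]; apply/orP; left.
  move: H => /=; case: ifP => _; first exact: sm.
  move=> /has_iotaP[z _ /andP[/sm m1 /sm m2]]; apply/has_iotaP.
  by exists z; [exact: mem3_ltn m1|rewrite m1 m2].
- move=> /and3P[-> /sm-> /all_iotaP H]; do 7 ![apply/orP; right].
  apply/all_iotaP => k /H/has_iotaP[v _ /sm m1]; apply/has_iotaP.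
  by exists v => //; exact/ltnW/(mem3_ltn m1).
Qed.

Definition derivable c x y := exists2 d, derivation d & mem3 d c x y.

Lemma derivable_justified d c x y :
  derivation d -> justified d c x y -> derivable c x y.
Proof.
move=> /all_iotaP chd st; pose t := npair c (npair x y).
(* The length exceeds every position occurring in [d] as well as [t], so the mask truncates
   nothing. *)
pose d' := bitmask (d + t).+1 (fun u => bit d u || (u == t)).
have bd' u : bit d' u = bit d u || (u == t).
  rewrite bit_bitmask andb_idl// => /orP[/bit_ltn ud|/eqP ->]; lia.
have dd' u : bit d u -> bit d' u by rewrite bd' => ->.
exists d'; last by rewrite /mem3 bd' eqxx orbT.
apply/all_iotaP => u _; apply/implyP; rewrite bd' => /orP[du|/eqP->].
  by apply: sub_justified dd' _; have := chd u (bit_ltn du); rewrite du.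
by rewrite !npairK; exact: sub_justified dd' st.
Qed.

(** The union of two derivations is a derivation. Arbitrary [n] is allowed because minimisation has
    as many premises as values tested. *)
Lemma derivable_union n (c x y : nat -> nat) :
  (forall k, k < n -> derivable (c k) (x k) (y k)) ->
  exists2 d, derivation d & forall k, k < n -> mem3 d (c k) (x k) (y k).
Proof.
elim: n => [_|n IHn H]; first by exists 0.
have [d1 /all_iotaP ch1 m1] := IHn (fun k kn => H k (ltnW kn)).
have [d2 /all_iotaP ch2 m2] := H n (leqnn _).
pose d := bitmask (d1 + d2) (fun u => bit d1 u || bit d2 u).
have bd u : bit d u = bit d1 u || bit d2 u.
  by rewrite bit_bitmask andb_idl// => /orP[]/bit_ltn ?; lia.
have s1 u : bit d1 u -> bit d u by rewrite bd => ->.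
have s2 u : bit d2 u -> bit d u by rewrite bd orbC => ->.
exists d.
  apply/all_iotaP => u _; apply/implyP; rewrite bd => /orP[du|du].
    by apply: sub_justified s1 _; have := ch1 u (bit_ltn du); rewrite du.
  by apply: sub_justified s2 _; have := ch2 u (bit_ltn du); rewrite du.
move=> k; rewrite ltnS leq_eqVlt => /orP[/eqP->|kn]; first exact/s2/m2.
exact/s1/m1.
Qed.

Lemma derivable_union2 c x y c' x' y' : derivable c x y -> derivable c' x' y' ->
  exists d, [/\ derivation d, mem3 d c x y & mem3 d c' x' y'].
Proof.
move=> D D'.
have [|d chd m] := @derivable_union 2 (fun k => if k is 0 then c else c')
  (fun k => if k is 0 then x else x') (fun k => if k is 0 then y else y').
  by case.
by exists d; split; [|exact: (m 0)|exact: (m 1)].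
Qed.

Lemma derivation0 : derivation 0. Proof. by []. Qed.

Lemma derivable_zero x : derivable czero x 0.
Proof. by apply: (derivable_justified derivation0); rewrite justifiedE. Qed.

Lemma derivable_succ x : derivable csucc x x.+1.
Proof. by apply: (derivable_justified derivation0); rewrite justifiedE. Qed.

Lemma derivable_fst x : derivable cfst x (nfst x).
Proof. by apply: (derivable_justified derivation0); rewrite justifiedE. Qed.

Lemma derivable_snd x : derivable csnd x (nsnd x).
Proof. by apply: (derivable_justified derivation0); rewrite justifiedE. Qed.

Lemma derivable_pair a b x y z : derivable a x y -> derivable b x z ->
  derivable (cpair a b) x (npair y z).
Proof.
move=> Da Db; have [d [chd ma mb]] := derivable_union2 Da Db.
by apply: (derivable_justified chd); rewrite justifiedE !npairK eqxx ma mb.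
Qed.

Lemma derivable_comp a b x y z : derivable b x z -> derivable a z y ->
  derivable (ccomp a b) x y.
Proof.
move=> Db Da; have [d [chd mb ma]] := derivable_union2 Db Da.
apply: (derivable_justified chd); rewrite justifiedE.
by apply/has_iotaP; exists z; [exact: mem3_ltn mb|rewrite mb].
Qed.

Lemma derivable_prec0 a b x y : derivable a x y ->
  derivable (cprec a b) (npair 0 x) y.
Proof.
move=> [d chd m]; apply: (derivable_justified chd).
by rewrite justifiedE.
Qed.

Lemma derivable_precS a b k x y z : derivable (cprec a b) (npair k x) z ->
  derivable b (npair k (npair z x)) y -> derivable (cprec a b) (npair k.+1 x) y.
Proof.
move=> D1 D2; have [d [chd m1 m2]] := derivable_union2 D1 D2.
apply: (derivable_justified chd); rewrite justifiedE.
by apply/has_iotaP; exists z; [exact: mem3_ltn m1|rewrite m1].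
Qed.

Lemma derivable_mini a x y (v : nat -> nat) : derivable a (npair y x) 0 ->
  (forall k, k < y -> derivable a (npair k x) (v k).+1) ->
  derivable (cmini a) x y.
Proof.
move=> D1 D2; have [|d chd m] := @derivable_union y.+1 (fun=> a)
  (fun k => npair k x) (fun k => if k < y then (v k).+1 else 0).
  move=> k; rewrite ltnS leq_eqVlt => /orP[/eqP->|ky]; rewrite ?ltnn ?ky//.
  exact: D2.
apply: (derivable_justified chd); rewrite justifiedE.
have := m y (leqnn _); rewrite ltnn => -> /=.
apply/all_iotaP => k ky; have := m k (ltnW ky); rewrite ky => mk.
by apply/has_iotaP; exists (v k) => //; exact/ltnW/(mem3_ltn mk).
Qed.

(** * Translation of Kleene schemes into coded programs *)

Definition tcode (s : seq nat) := foldr npair 0 s.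

(** An argument list is a nested pair ending in 0; hence the [i]-th projection takes [csnd] [i]
    times and then [cfst], and the inner functions of a composition are collected by a chain of
    [cpair]. *)
Fixpoint code n (c : recfun n) : nat :=
  match c with
  | Zero _ => czero
  | Succ => ccomp csucc cfst
  | Proj _ i => iter i (fun a => ccomp a csnd) cfst
  | Comp k _ f g => ccomp (code f)
      (foldr cpair czero [seq code (g i) | i <- enum 'I_k])
  | Prec _ f g => cprec (code f) (code g)
  | Mini _ f => cmini (code f)
  end.

Lemma tcode_thead n (xs : n.+1.-tuple nat) :
  tcode xs = npair (thead xs) (tcode [tuple of behead xs]).
Proof. by case/tupleP: xs => x xs; rewrite theadE. Qed.

Lemma derivable_proj (s : seq nat) i : i < size s ->
  derivable (iter i (fun a => ccomp a csnd) cfst) (tcode s) (nth 0 s i).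
Proof.
elim: i s => [|i IHi] [|x s] //=.
  by move=> _; have := derivable_fst (npair x (tcode s)); rewrite npairK.
rewrite ltnS => /IHi; apply: derivable_comp.
by have := derivable_snd (npair x (tcode s)); rewrite npairK.
Qed.

Lemma derivable_seq (I : Type) (s : seq I) (c y : I -> nat) x :
  (forall i, derivable (c i) x (y i)) ->
  derivable (foldr cpair czero (map c s)) x (tcode (map y s)).
Proof.
move=> cxy; elim: s => [|i s IHs]; first exact: derivable_zero.
exact: derivable_pair (cxy i) IHs.
Qed.

Lemma derivable_code n (c : recfun n) xs y :
  computes c xs y -> derivable (code c) (tcode xs) y.
Proof.
elim: c xs y => {n} [n||n i|k n f IHf g IHg|n f IHf g IHg|n f IHf] xs y.
- by move=> /= ->; exact: derivable_zero.
- move=> /= ->; apply: derivable_comp (derivable_succ _).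
  rewrite tcode_thead; set t := tcode _.
  by rewrite -{2}(nfst_npair (thead xs) t); exact: derivable_fst.
- by move=> /= ->; rewrite (tnth_nth 0); apply: derivable_proj; rewrite size_tuple.
- move=> [ys [gys /IHf fy]] /=; apply: derivable_comp fy.
  rewrite -(map_tnth_enum ys).
  by apply: derivable_seq => i; exact/IHg/gys.
- move=> [h [/IHf f0 gh ->]] /=; rewrite tcode_thead.
  (* Frees the recursion argument for an induction while keeping the bound under which the trace [h]
     is known to be correct. *)
  have : thead xs <= thead xs by [].
  elim: {1 3 4}(thead xs) => [_|k IHk kx]; first exact: derivable_prec0.
  apply: derivable_precS (IHk (ltnW kx)) _.
  by have := IHg _ _ (gh k kx).
- move=> [/IHf fy fly] /=.
  (* Collects the nonzero values below [y] into one function; from [y] on its value is arbitrary. *)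
  have /choice[v vP] : forall k, exists v, k < y ->
      computes f [tuple of k :: xs] v.+1.
    move=> k; case: (boolP (k < y)) => [/fly[v fv]|_]; first by exists v.
    by exists 0.
  by apply: (@derivable_mini _ _ _ v) => // k /vP/IHf.
Qed.

Lemma mem3_proj d (s : seq nat) i y : derivation d -> i < size s ->
  mem3 d (iter i (fun a => ccomp a csnd) cfst) (tcode s) y -> y = nth 0 s i.
Proof.
move=> chd; elim: i s y => [|i IHi] [|x s] y //=.
  by move=> _ /(derivationP chd); rewrite justifiedE ?npairK => /eqP.
rewrite ltnS => /IHi{}IHi /(derivationP chd); rewrite justifiedE ?npairK.
move=> /has_iotaP[z _ /andP[/(derivationP chd)]].
by rewrite justifiedE ?npairK => /eqP-> /IHi.
Qed.

Lemma mem3_seq d (I : Type) (s : seq I) (c y : I -> nat) x z : derivation d ->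
  (forall i v, mem3 d (c i) x v -> v = y i) ->
  mem3 d (foldr cpair czero (map c s)) x z -> z = tcode (map y s).
Proof.
move=> chd cxy; elim: s z => [|i s IHs] z /(derivationP chd).
  by rewrite justifiedE => /eqP.
by rewrite /= justifiedE => /and3P[/eqP ez /cxy m1 /IHs m2]; rewrite ez m1 m2.
Qed.

(** Soundness of derivations at inputs where [c] is defined. The induction follows [c], and the
    recursion argument for [Prec], not the derivation; circular derivations are therefore
    harmless. *)
Lemma mem3_code d n (c : recfun n) xs y z : derivation d ->
  computes c xs y -> mem3 d (code c) (tcode xs) z -> z = y.
Proof.
move=> chd.
elim: c xs y z => {n} [n||n i|k n f IHf g IHg|n f IHf g IHg|n f IHf] xs y z.
- by move=> /= -> /(derivationP chd); rewrite justifiedE => /eqP.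
- move=> /= -> /(derivationP chd); rewrite justifiedE.
  move=> /has_iotaP[v _ /andP[/(derivationP chd)]].
  rewrite justifiedE => /eqP-> /(derivationP chd).
  by rewrite justifiedE => /eqP->; rewrite tcode_thead npairK.
- move=> /= ->; rewrite (tnth_nth 0) => /(mem3_proj chd) -> //.
  by rewrite size_tuple.
- move=> [ys [gys fy]] /= /(derivationP chd); rewrite justifiedE.
  move=> /has_iotaP[v _ /andP[/(@mem3_seq _ _ _ _ (tnth ys)) E]].
  rewrite {}E//; last by move=> i u; exact: (IHg i _ _ _ (gys i)).
  by rewrite map_tnth_enum; exact: (IHf _ _ _ fy).
- move=> [h [f0 gh ->]] /=; rewrite tcode_thead.
  have : thead xs <= thead xs by [].
  elim: {1 3 4}(thead xs) z => [z _|k IHk z kx] /(derivationP chd).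
    by rewrite justifiedE; exact: (IHf _ _ _ f0).
  rewrite justifiedE => /has_iotaP[v _ /andP[/(IHk _ (ltnW kx))->]].
  exact: (IHg _ _ _ (gh k kx)).
- move=> [fy fly] /= /(derivationP chd); rewrite justifiedE.
  move=> /andP[mz /all_iotaP flz].
  have [zy|yz|//] := ltngtP z y.
    have [v fv] := fly _ zy.
    by have := IHf _ _ 0 fv mz.
  have /has_iotaP[v _ mv] := flz _ yz.
  by have := IHf _ _ v.+1 fy mv.
Qed.

(** * The enumeration and its splitting *)

(* [s = npair x (npair y d)], where [d] derives that program [nfst x] returns
   [y] on input [x]; hence [y <= s]. *)
Definition halts s :=
  derivation (nsnd (nsnd s)) &&
  mem3 (nsnd (nsnd s)) (nfst (nfst s)) (npair (nfst s) 0) (nfst (nsnd s)).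

(** Only the least halting witness counts, so each element of [C] enters at exactly one stage,
    namely that witness. *)
Definition event s :=
  halts s && all (fun t => (nfst t == nfst s) ==> ~~ halts t) (iota 0 s).

Lemma computable_halts f :
  computable f -> computable_bool (fun w => halts (f w)).
Proof. by move=> cf; rewrite /halts; computability. Qed.
#[global] Hint Resolve computable_halts : comp.

Lemma computable_event f :
  computable f -> computable_bool (fun w => event (f w)).
Proof. by move=> cf; rewrite /event; computability. Qed.
#[global] Hint Resolve computable_event : comp.

Lemma event_inj s t : event s -> event t -> nfst s = nfst t -> s = t.
Proof.
move=> /andP[hs /all_iotaP fs] /andP[ht /all_iotaP ft] st.
have [/ft|/fs|//] := ltngtP s t; first by rewrite st eqxx hs.
by rewrite st eqxx ht.
Qed.

Lemma halts_event s : halts s -> exists2 t, event t & nfst t = nfst s.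
Proof.
move=> hs; pose P t := halts t && (nfst t == nfst s).
have exP : exists t, P t by exists s; rewrite /P hs eqxx.
case: (ex_minnP exP) => t /andP[ht /eqP ts] tmin; exists t => //.
rewrite /event ht; apply/all_iotaP => u ut; apply/implyP; rewrite ts => us.
by apply: contraL ut => hu; rewrite -leqNgt; apply: tmin; rewrite /P hu us.
Qed.

(** The diagonal step: [e] is the code of a program for [f]. Each [x] with [nfst x = e] enters [C]
    since [f] is total, and the stage of entry, a tuple containing the value [f x], is at least that
    value. *)
Lemma computable_event_delay f : computable f ->
  exists e, forall x, nfst x = e ->
    (exists2 s, event s & nfst s = x) /\
    (forall s, event s -> nfst s = x -> f x <= s).
Proof.
move=> [c cP]; exists (code c) => x xe; split.
  have [d chd md] := derivable_code (cP x).
  have [|t et] := @halts_event (npair x (npair (f x) d)).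
    by rewrite /halts !npairK xe chd.
  by rewrite npairK => tx; exists t.
move=> s /andP[/andP[chd md] _] sx; move: md; rewrite sx xe.
move=> /(mem3_code chd (cP x)) <-.
by rewrite (leq_trans (nfst_leq _)) ?nsnd_leq.
Qed.

(** Inputs belonging to a fixed program [e] occur at all [r * r + e] with [e <= r]. The ratios of
    consecutive ones are bounded, as the final linear estimate requires. *)
Lemma nfst_sqr e r : e <= r -> nfst (r * r + e) = e.
Proof.
by move=> er; rewrite /nfst (@nsqrt_uniq _ r) ?addKn//; nia.
Qed.

Lemma event_unbounded N : exists2 s, N <= s & event s.
Proof.
have [e eP] := computable_event_delay (computable_const N).
have [[s es sx] fs] := eP (e * e + e) (nfst_sqr (leqnn e)).
by exists s => //; exact: fs.
Qed.

(* Numbers below a marker [m = t.+1] set at stage [t], and not below the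
   previous marker, are to enter the same side of the splitting from then on;
   consecutive markers stand for different sides. A new element [nfst s]
   respects the first marker above it and cancels the later ones.
   Marker [0] is a sentinel. *)
Definition update_marks s m :=
  bitmask s.+2 (fun j => (j == s.+1) ||
    (bit m j && ~~ has (fun i => bit m i && (nfst s < i)) (iota 0 j))).

(** The initial mask [1] codes the set whose only member is the sentinel. *)
Definition marks s :=
  nat_rect (fun=> nat) 1 (fun t m => if event t then update_marks t m else m) s.

(** Taking the parity of a count of markers makes the side change at each marker crossed. *)
Definition side s := odd (\sum_(j < (nfst s).+1) bit (marks s) j).

Definition half_enum p s x :=
  has (fun t => [&& event t, side t == p & nfst t == x]) (iota 0 s).

Lemma computable_update_marks f g : computable f -> computable g ->
  computable (fun w => update_marks (f w) (g w)).
Proof. by move=> cf cg; rewrite /update_marks; computability. Qed.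
#[global] Hint Resolve computable_update_marks : comp.

Lemma computable_marks f : computable f -> computable (fun w => marks (f w)).
Proof.
move=> cf; apply: (@computable_rec (fun=> 1) f
  (fun t m _ => if event t then update_marks t m else m)) => //; computability.
Qed.
#[global] Hint Resolve computable_marks : comp.

Lemma computable_side f : computable f -> computable_bool (fun w => side (f w)).
Proof.
move=> cf; apply: computable_odd.
by apply: (@computable_sum (fun j w => bit (marks (f w)) j)); computability.
Qed.
#[global] Hint Resolve computable_side : comp.

Lemma computable_half p f g : computable f -> computable g ->
  computable_bool (fun w => half_enum p (f w) (g w)).
Proof.
move=> cf cg; rewrite /half_enum.
apply: (@computable_has
  (fun t w => [&& event t, side t == p & nfst t == g w])) => //.
  move=> y x cy cx; case: p.
    by under eq_fun do rewrite eqb_id; computability.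
  by under eq_fun do rewrite eqbF_neg; computability.
Qed.
#[global] Hint Resolve computable_half : comp.

Lemma marks_leq s j : bit (marks s) j -> j <= s.
Proof.
elim: s => [|s IHs] /=.
  by rewrite /bit; case: j => // j; rewrite divn_small// -[1]/(2^0) ltn_exp2l.
by case: ifP => _; [rewrite bit_bitmask ltnS => /andP[]|move/IHs/leqW].
Qed.

Lemma bit_marksS s j : event s -> bit (marks s.+1) j = (j == s.+1) ||
  (bit (marks s) j &&
     ~~ has (fun i => bit (marks s) i && (nfst s < i)) (iota 0 j)).
Proof.
move=> es; rewrite /= es bit_bitmask andb_idl//.
move=> /orP[/eqP->//|/andP[/marks_leq]].
by rewrite ltnS => /leqW.
Qed.

(** Marker [j] can be set only on passing from stage [j.-1] to stage [j]; once cancelled it never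
    returns. *)
Lemma marks_anti j s t : j <= s <= t -> bit (marks t) j -> bit (marks s) j.
Proof.
move=> /andP[js]; elim: t => [|t IHt]; first by rewrite leqn0 => /eqP->.
rewrite leq_eqVlt => /orP[/eqP->//|st]; have {}IHt := IHt st.
have [et|/negbTE et] := boolP (event t); last by rewrite /= et.
rewrite bit_marksS// => /orP[/eqP jt|/andP[/IHt]//].
by move: st; lia.
Qed.

(** Whatever cancels [j], an earlier marker above the new element, also cancels every marker beyond
    [j]. So the survival of [m] protects all markers below it. *)
Lemma marks_below j m s t : j < m -> m <= s <= t ->
  bit (marks t) m -> bit (marks s) j -> bit (marks t) j.
Proof.
move=> jm /andP[ms]; elim: t => [|t IHt]; first by rewrite leqn0 => /eqP->.
rewrite leq_eqVlt => /orP[/eqP->//|st mt js].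
have mt' : bit (marks t) m by apply: marks_anti mt; lia.
have jt := IHt st mt' js.
have [et|/negbTE et] := boolP (event t); last by rewrite /= et.
move: mt; rewrite !bit_marksS// jt /=.
move=> /orP[/eqP mt|/andP[_ /has_iotaP nm]]; first lia.
apply/orP; right; apply/has_iotaP => -[i ij iP]; apply: nm.
by exists i => //; exact: ltn_trans ij jm.
Qed.

(** * Permanent markers *)

Definition final_mark m := forall s, m <= s -> bit (marks s) m.

Definition idx m := \sum_(j < m) bit (marks m) j.

Lemma final_below m s j : final_mark m -> m <= s -> j < m ->
  bit (marks s) j = bit (marks m) j.
Proof.
move=> fm ms jm; apply/idP/idP.
  by apply: marks_anti; rewrite (ltnW jm).
by apply: (marks_below jm) (fm _ ms); rewrite leqnn.
Qed.

(** Since [m] survives stage [s], no marker lies strictly between [nfst s] and [m]. The markers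
    counted by [side s] are thus all those below [m], and these no longer change. *)
Lemma final_side m s : final_mark m -> m <= s -> event s -> nfst s < m ->
  side s = odd (idx m).
Proof.
move=> fm ms es xm; rewrite /side /idx; congr odd.
rewrite -!(big_mkord xpredT (fun j => bit (marks _) j : nat)).
rewrite [RHS](big_cat_nat (n := (nfst s).+1))//= [X in _ = _ + X]big_nat.
rewrite [X in _ = _ + X]big1 ?addn0.
  apply: eq_big_nat => j /andP[_ jx]; rewrite (final_below fm)//.
  exact: leq_trans jx xm.
move=> j /andP[xj jm]; rewrite -(final_below fm ms jm).
have := fm s.+1 (leqW ms); rewrite bit_marksS//.
move=> /orP[/eqP|/andP[_ /has_iotaP nm]]; first lia.
by case E: (bit (marks s) j) => //; case: nm; exists j => //; rewrite E.
Qed.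

Lemma idx_leq m : idx m <= m.
Proof.
rewrite /idx -[X in _ <= X]card_ord -sum1_card.
by apply: leq_sum => j _; case: bit.
Qed.

Lemma final0 : final_mark 0.
Proof.
elim=> [|s IHs] _; first by rewrite /bit.
have [es|/negbTE es] := boolP (event s); last by rewrite /= es; exact: IHs.
by rewrite bit_marksS// IHs.
Qed.

(** Each of the finitely many numbers below [m] enters at most once, by [event_inj]. *)
Lemma event_large m : exists S, forall s, S <= s -> event s -> m <= nfst s.
Proof.
elim: m => [|m [S SP]]; first by exists 0.
have [[t et tm]|nm] := pselect (exists2 t, event t & nfst t = m).
  exists (maxn S t.+1) => s; rewrite geq_max => /andP[Ss ts] es.
  rewrite ltn_neqAle SP// andbT; apply: contraTneq ts => ms.
  by rewrite (event_inj et es) ?tm ?ltnn.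
exists S => s Ss es; rewrite ltn_neqAle SP// andbT; apply/eqP => ms.
by apply: nm; exists s.
Qed.

(** Once no number below [m] enters any more, the first marker [m'] beyond [m] is permanent: a
    marker cancelling it would lie below [m'], hence not beyond [m], and yet above an entering
    number that is at least [m]. *)
Lemma final_next m :
  final_mark m -> exists2 m', final_mark m' & idx m' = (idx m).+1.
Proof.
move=> fm; have [S SP] := event_large m.
have [u] := event_unbounded (maxn S m); rewrite geq_max => /andP[Su mu] eu.
(* The event at stage [u] has just set the marker [u.+1], so some marker beyond [m] exists. *)
pose P j := bit (marks u.+1) j && (m < j).
have exP : exists j, P j by exists u.+1; rewrite /P bit_marksS// eqxx /=.
case: (ex_minnP exP) => m' /andP[mm' lt_m] m'min.
have m'u := marks_leq mm'.
(* Positions between [m] and [m'] carry no marker at stage [u.+1], and are too small to receive one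
   later. *)
have gap v j : u < v -> m < j -> j < m' -> bit (marks v) j = false.
  move=> uv mj jm'; have jm := ltnW jm'.
  apply: contraTF jm' => bj; rewrite -leqNgt m'min// /P mj andbT.
  by apply: marks_anti bj; rewrite uv andbT; exact: leq_trans m'u.
have stay v : u < v -> bit (marks v) m'.
  elim: v => // v IHv; rewrite ltnS leq_eqVlt => /orP[/eqP<-//|uv].
  have [ev|/negbTE ev] := boolP (event v); last by rewrite /= ev; exact: IHv.
  rewrite bit_marksS// IHv//=; apply/orP; right.
  apply/has_iotaP => -[i im' /andP[bi xi]].
  have [im|mi] := leqP i m; last by rewrite (gap v i) in bi.
  by have := SP v _ ev; lia.
have fm' : final_mark m'.
  move=> s m's; have [us|su] := ltnP u s; first exact: stay.
  by apply: marks_anti mm'; rewrite m's; lia.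
exists m' => //; rewrite /idx.
under eq_bigr do rewrite -(final_below fm' m'u)//.
have mM := fm u.+1 (leqW mu); have belowM j := @final_below m u.+1 j fm (leqW mu).
have gapM j := gap u.+1 j (leqnn _).
rewrite -!(big_mkord xpredT (fun j => bit (marks _) j : nat)).
set M := marks u.+1 in mM belowM gapM *.
rewrite (big_cat_nat (n := m.+1))//= big_nat_recr//= mM.
rewrite [X in _ + X]big_nat [X in _ + X]big1; last first.
  by move=> j /andP[mj jm']; rewrite gapM.
rewrite addn0 addn1; congr _.+1; apply: eq_big_nat => j /andP[_ jm].
by rewrite belowM.
Qed.

Lemma final_idx i : exists2 m, final_mark m & idx m = i.
Proof.
elim: i => [|i [m fm <-]]; last exact: final_next.
by exists 0; [exact: final0|rewrite /idx big_ord0].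
Qed.

Lemma half_mono p s t x : s <= t -> half_enum p s x -> half_enum p t x.
Proof.
move=> st /has_iotaP[u us uP]; apply/has_iotaP; exists u => //.
exact: leq_trans us st.
Qed.

(** Take a permanent marker [m] whose index has parity [~~ p]: all numbers below [m] entering from
    stage [m] on join the other half. The index [N.*2 + ~~ p] also bounds [m] from below. *)
Lemma half_settled p N : exists2 m, N <= m &
  forall s x, x < m -> half_enum p s x -> half_enum p m x.
Proof.
have [m fm idxm] := final_idx (N.*2 + ~~ p).
exists m.
  by apply: leq_trans (idx_leq m); rewrite idxm -addnn -addnA leq_addr.
move=> s x xm /has_iotaP[t _ /and3P[et /eqP sp /eqP tx]].
apply/has_iotaP; exists t; last by rewrite et sp tx !eqxx.
rewrite ltnNge; apply/negP => mt.
have := final_side fm mt et; rewrite tx => /(_ xm).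
by rewrite sp idxm oddD odd_double; case: (p).
Qed.

(** * Dyadic approximations of real numbers *)

Import Order.TTheory GRing.Theory Num.Theory.
Import numFieldNormedType.Exports.
Local Open Scope ring_scope.

Definition binsum (R : realType) (P : pred nat) n : R :=
  \sum_(0 <= k < n | P k) 2 ^- k.+1.

Lemma exp2V_gt0 (R : realType) n : 0 < 2 ^- n :> R.
Proof. by rewrite invr_gt0 exprn_gt0. Qed.

Lemma exp2VS (R : realType) n : 2 ^- n = 2 * 2 ^- n.+1 :> R.
Proof. by rewrite exprS invfM mulrA divff// mul1r. Qed.

Lemma ler_exp2V (R : realType) m n : (m <= n)%N -> 2 ^- n <= 2 ^- m :> R.
Proof. by move=> mn; rewrite lef_pV2 ?posrE ?exprn_gt0// ler_eXn2l ?ltr1n. Qed.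

Lemma binsumS (R : realType) (P : pred nat) n :
  binsum R P n.+1 = binsum R P n + (if P n then 2 ^- n.+1 else 0).
Proof. by rewrite /binsum big_mkcond big_nat_recr//= -big_mkcond. Qed.

Lemma binsum_ge0 (R : realType) (P : pred nat) n : 0 <= binsum R P n.
Proof. by apply: sumr_ge0 => k _; rewrite ltW// exp2V_gt0. Qed.

Lemma le_binsum (R : realType) (P Q : pred nat) n :
  (forall k, (k < n)%N -> P k -> Q k) -> binsum R P n <= binsum R Q n.
Proof.
elim: n => [|n IHn] PQ; first by rewrite /binsum !big_geq.
rewrite !binsumS lerD//; first by apply: IHn => k kn; apply/PQ/ltnW.
have := PQ n (ltnSn _); case: (P n) => [->//|_].
by case: (Q n); rewrite // ltW ?exp2V_gt0.
Qed.

Lemma binsum_extra (R : realType) (P Q : pred nat) n x :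
  (forall k, (k < n)%N -> P k -> Q k) -> (x < n)%N -> Q x -> ~~ P x ->
  binsum R P n + 2 ^- x.+1 <= binsum R Q n.
Proof.
move=> PQ xn Qx Px; pose P' := predU1 x P.
apply: le_trans (le_binsum (P := P') R _); last first.
  by move=> k kn /orP[/eqP->//|]; exact: PQ.
elim: n xn {PQ} => // n IHn; rewrite ltnS leq_eqVlt !binsumS => /orP[/eqP xn|xn].
  rewrite -xn (negbTE Px) /P' /= eqxx addr0 lerD2r.
  by apply: le_binsum => k _ Pk; rewrite /= Pk orbT.
rewrite addrAC lerD ?IHn//= [n == x](negbTE _) ?lexx//.
by rewrite neq_ltn xn orbT.
Qed.

Lemma binsum_mono (R : realType) P m n :
  (m <= n)%N -> binsum R P m <= binsum R P n.
Proof.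
elim: n => [|n IHn]; first by rewrite leqn0 => /eqP->.
rewrite leq_eqVlt => /orP[/eqP->//|/IHn/le_trans->//].
by rewrite binsumS lerDl; case: ifP => // _; rewrite ltW// exp2V_gt0.
Qed.

Lemma binsum_tail (R : realType) P m n : (m <= n)%N ->
  binsum R P n <= binsum R P m + 2 ^- m - 2 ^- n.
Proof.
elim: n => [|n IHn]; first by rewrite leqn0 => /eqP->; rewrite addrK.
rewrite leq_eqVlt => /orP[/eqP->|/IHn]; first by rewrite addrK.
rewrite binsumS (exp2VS R n); have := exp2V_gt0 R n.+1.
by case: (P n); lra.
Qed.

(** The scaled binary sum is a natural number, which makes it accessible to computable functions.
    For [k < n] the exponent [n.-1 - k] equals [n - k.+1]. *)
Lemma binsum_nat (R : realType) (P : pred nat) n :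
  (\sum_(k < n) P k * 2 ^ (n.-1 - k))%N%:R = 2 ^+ n * binsum R P n.
Proof.
rewrite natr_sum /binsum big_mkord [X in _ * X]big_mkcond /= mulr_sumr.
apply: eq_bigr => k _; case: (P k); last by rewrite mulr0 mul0n.
have -> : 2 ^+ n = 2 ^+ k.+1 * 2 ^+ (n.-1 - k) :> R.
  by rewrite -exprD; congr (_ ^+ _); have := ltn_ord k; lia.
by rewrite mul1n natrX mulrAC divff ?mul1r// expf_neq0// pnatr_eq0.
Qed.

Lemma real_of_set_bounds (R : realType) (A : set nat) n :
  binsum R (mem A) n <= real_of_set R A <= binsum R (mem A) n + 2 ^- n.
Proof.
have mono : nondecreasing_seq (binsum R (mem A)).
  by move=> m k; exact: binsum_mono.
have le1 k : binsum R (mem A) k <= binsum R (mem A) n + 2 ^- n.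
  have := binsum_tail R (mem A) (leq_maxr k n); have := exp2V_gt0 R (maxn k n).
  by have := binsum_mono R (mem A) (leq_maxl k n); lra.
have cvg : cvgn (binsum R (mem A)).
  apply: nondecreasing_is_cvgn => //.
  by exists (binsum R (mem A) n + 2 ^- n) => _ [k _ <-].
apply/andP; split; first exact: nondecreasing_cvgn_le.
by apply: limr_le => //; apply: nearW.
Qed.

(** * Enumerations versus regaining approximations *)

Lemma infinite_set_nat (A : set nat) :
  infinite_set A <-> forall N, exists2 n, (N <= n)%N & A n.
Proof.
split=> [infA N|unbA].
  apply: contrapT => nA; apply: infA.
  apply: (@sub_finite_set _ _ `I_N); last exact: finite_II.
  move=> n An /=; rewrite ltnNge; apply/negP => Nn.
  by apply: nA; exists n.
move=> /finite_fsetP[X AX].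
have [n] := unbA (\max_(i <- finmap.enum_fset X) i).+1.
rewrite AX /= => + nX; rewrite ltnNge => /negP; apply.
exact: (@leq_bigmax_seq _ _ xpredT id).
Qed.

Lemma finitely_many_settle (b : nat -> nat -> bool) N :
  (forall s t x, (s <= t)%N -> b s x -> b t x) ->
  exists s, forall t x, (x < N)%N -> b t x -> b s x.
Proof.
move=> mono; elim: N => [|k [s IHs]]; first by exists 0%N.
have [[t bt]|nA] := pselect (exists t, b t k).
  exists (maxn s t) => u x; rewrite ltnS leq_eqVlt => /orP[/eqP-> _|xk bu].
    exact: mono (leq_maxr _ _) bt.
  exact: mono (leq_maxl _ _) (IHs u x xk bu).
exists s => u x; rewrite ltnS leq_eqVlt => /orP[/eqP-> bu|]; last exact: IHs.
by case: nA; exists u.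
Qed.

(** The approximation at [n] sums the first [n.+2] digits as enumerated by stage [n]. If these are
    settled, the error is at most [2 ^- n.+2], which is less than [2 ^- n]. *)
Lemma regainingly_approximable_enum (R : realType) (b : nat -> nat -> bool) :
  (forall f g, computable f -> computable g ->
     computable_bool (fun w => b (f w) (g w))) ->
  (forall s t x, (s <= t)%N -> b s x -> b t x) ->
  (forall N, exists2 n, (N <= n)%N &
     forall s x, (x <= n.+1)%N -> b s x -> b n x) ->
  regainingly_approximable_set R [set x | exists s, b s x].
Proof.
move=> cb mono settle; set A := [set x | _]; split; first exact: ce_ex.
have bA n N : binsum R (b n) N <= binsum R (mem A) N.
  by apply: le_binsum => k _ bk; apply/mem_set; exists n.
pose p n := (\sum_(k < n.+2) b n k * 2 ^ (n.+1 - k))%N.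
(* The trivial sign factor gives [a] literally the shape asked for by [computable_rat_seq]. *)
pose a n : rat := (-1) ^+ 0 * (p n)%:R / (2 ^ n.+2)%:R.
have aE n : ratr (a n) = binsum R (b n) n.+2.
  rewrite /a expr0 mul1r rmorphM /= fmorphV /= !ratr_nat natrX /p.
  by rewrite (binsum_nat R (b n) n.+2) mulrC mulKf// expf_neq0// pnatr_eq0.
have amono : {homo a : m n / (m <= n)%N >-> m <= n}.
  move=> m n mn; rewrite -(ler_rat R) !aE.
  apply: le_trans (binsum_mono _ _ (_ : m.+2 <= n.+2)%N) => //.
  by apply: le_binsum => k _; exact: mono.
exists a; split=> //.
- exists (fun=> 0%N), p, (fun n => 2 ^ n.+2)%N; split.
  + exact: computable_const.
  + apply: (@computable_sum (fun k n => b n k * 2 ^ (n.+1 - k))%N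
      (fun n => n.+2)).
      by move=> y x cy cx; have := cb _ _ cx cy; computability.
    by computability.
  + by computability.
  + by move=> n; rewrite expn_eq0.
- apply/cvgrPdist_le => e e0.
  have [N Ne] : exists N, 2 ^- N <= e.
    exists (Num.bound e^-1); rewrite invf_ple ?posrE ?exprn_gt0//.
    apply: ltW; apply: lt_le_trans (archi_boundP _) _.
      by rewrite invr_ge0 ltW.
    by rewrite -natrX ler_nat ltnW// ltn_expl.
  have [s sN] := finitely_many_settle N mono.
  near=> n; have sn : (s <= n)%N by near: n; exact: nbhs_infty_ge.
  have Nn : (N <= n.+2)%N.
    by rewrite (@leq_trans n)//; [near: n; exact: nbhs_infty_ge|lia].
  rewrite aE; have /andP[l u] := real_of_set_bounds R A N.
  have /andP[l2 _] := real_of_set_bounds R A n.+2.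
  (* From stage [s] on everything below [N] is present, so at most the tail [2 ^- N] is missing. *)
  have : binsum R (mem A) N <= binsum R (b n) n.+2.
    apply: le_trans (binsum_mono _ _ Nn); apply: le_binsum => k kN /set_mem[t bt].
    exact: mono sn (sN _ _ kN bt).
  have := bA n n.+2; rewrite ler_norml; lra.
apply/infinite_set_nat => N; have [n Nn nP] := settle N.
exists n => //=; rewrite aE.
have /andP[_ u] := real_of_set_bounds R A n.+2.
have : binsum R (mem A) n.+2 <= binsum R (b n) n.+2.
  by apply: le_binsum => k kn /set_mem[s]; exact: nP.
have := exp2V_gt0 R n.+2; have := exp2VS R n; have := exp2VS R n.+1; lra.
Unshelve. all: by end_near.
Qed.

(** [g m] is the integer part of [2 ^+ m] times the term, replaced by 0 when the sign is negative;
    both bounds survive this because such a term is at most 0 and [alpha] is nonnegative. *)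
Lemma computable_floor (R : realType) (a : nat -> rat) : computable_rat_seq a ->
  exists2 g, computable g & forall m,
    2 ^+ m * ratr (a m) < (g m).+1%:R :> R /\
    forall alpha : R, 0 <= alpha -> ratr (a m) <= alpha ->
      (g m)%:R <= 2 ^+ m * alpha.
Proof.
move=> [s [p [q [cs cp cq spqP]]]].
exists (fun m => if odd (s m) then 0%N else (p m * 2 ^ m) %/ q m)%N.
  by computability.
move=> m; have [q0 aE] := spqP m.
have q0R : 0 < (q m)%:R :> R by rewrite ltr0n lt0n.
have m0 : 0 < 2 ^+ m :> R by rewrite exprn_gt0.
have {aE} : ratr (a m) = (-1) ^+ s m * ((p m)%:R / (q m)%:R) :> R.
  by rewrite aE !rmorphM /= fmorphV rmorphXn /= rmorphN1 !ratr_nat mulrA.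
have pq0 : 0 <= (p m)%:R / (q m)%:R :> R by rewrite divr_ge0.
rewrite -signr_odd; case: ifP => _ ->.
  rewrite expr1 mulN1r; split=> [|alpha a0 _]; last by rewrite mulr_ge0// ltW.
  by rewrite mulrN (le_lt_trans _ ltr01)// oppr_le0 mulr_ge0// ltW.
rewrite expr0 mul1r mulrA; split=> [|alpha a0 aE].
  rewrite ltr_pdivrMr// mulrC -natrX -!natrM ltr_nat -ltn_divLR ?lt0n//.
apply: le_trans (_ : 2 ^+ m * ((p m)%:R / (q m)%:R) <= _); last first.
  by rewrite ler_pM2l.
rewrite mulrA ler_pdivlMr// mulrC [2 ^+ m * _]mulrC -natrX -!natrM ler_nat mulnC.
exact: leq_divM.
Qed.

(** At stage [h m] the first [m] digits sum to more than [a m] minus [2 * 2 ^- m]. If [n] is a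
    regaining index and [n <= m], then by monotonicity of [a] this is more than [alpha] minus
    [3 * 2 ^- n], whereas a missing [x] with [x.+3 <= n] would cost at least [4 * 2 ^- n]. Allowing
    all [m >= n] avoids having to compute [n]. *)
Lemma regainingly_approximable_settle (R : realType) (b : nat -> nat -> bool) :
  (forall f g, computable f -> computable g ->
     computable_bool (fun w => b (f w) (g w))) ->
  (forall s t x, (s <= t)%N -> b s x -> b t x) ->
  regainingly_approximable (real_of_set R [set x | exists s, b s x]) ->
  exists2 h, computable h & forall N, exists2 n, (N <= n)%N &
    forall m s x, (n <= m)%N -> (x.+3 <= n)%N -> b s x -> b (h m) x.
Proof.
move=> cb mono; set A := [set x | _] => -[a [ca amono acvg ainf]].
set alpha := real_of_set R A in acvg ainf.
have [g cg gP] := computable_floor R ca.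
have a_le n : ratr (a n) <= alpha.
  have <- := cvg_lim (@Rhausdorff R) acvg.
  apply: (@nondecreasing_cvgn_le R (fun n => ratr (a n))).
    by move=> i j ij; rewrite ler_rat amono.
  by apply/cvg_ex; exists alpha.
have alpha0 : 0 <= alpha.
  have /andP[l _] := real_of_set_bounds R A 0.
  exact: le_trans (binsum_ge0 _ _ _) l.
pose V s m := (\sum_(k < m) b s k * 2 ^ (m.-1 - k))%N.
have VE s m : (V s m)%:R = 2 ^+ m * binsum R (b s) m by exact: binsum_nat.
(* The slack of one unit, worth [2 ^- m], covers the digits from [m] on; hence the search ends as
   soon as the digits below [m] are settled. *)
have [|m|h ch hP] := @computable_search (fun s m => g m <= (V s m).+1)%N.
- move=> y x cy cx; apply: computable_leq; first exact: computable_comp cg cx.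
  apply: computable_succ.
  apply: (@computable_sum (fun k w => b (y w) k * 2 ^ ((x w).-1 - k))%N x) => //.
  by move=> u v cu cv; have := cb _ _ (computable_comp cy cv) cu; computability.
- have [s sm] := finitely_many_settle m mono.
  exists s; rewrite -(ler_nat R).
  apply: le_trans (proj2 (gP m) _ alpha0 (a_le m)) _.
  rewrite -(natr1 (V s m)) VE.
  have /andP[_ u] := real_of_set_bounds R A m.
  have m0 : 0 < 2 ^+ m :> R by rewrite exprn_gt0.
  apply: (@le_trans _ _ (2 ^+ m * (binsum R (b s) m + 2 ^- m))); last first.
    by rewrite mulrDr mulfV// lt0r_neq0.
  rewrite ler_pM2l//.
  apply: le_trans u _; rewrite lerD2r; apply: le_binsum => k km /set_mem[t].
  exact: sm.
exists h => // N; have /infinite_set_nat/(_ N)[n Nn /= an] := ainf.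
exists n => // m s x nm xn bs; apply: contraT => nb.
have xm : (x < m)%N by lia.
have /andP[+ _] := real_of_set_bounds R A m; rewrite -/alpha => l.
have := @binsum_extra R (b (h m)) (mem A) m x; move=> /(_ _ xm _ nb) H.
have {H} : binsum R (b (h m)) m + 2 ^- x.+1 <= binsum R (mem A) m.
  by apply: H => [k _ bk|]; apply/mem_set; [exists (h m)|exists s].
have [] := gP m; have [] := hP m; rewrite -(ler_nat R) => + _ + _.
rewrite -(natr1 (V (h m) m)) -(natr1 (g m)) VE => g1 g2.
have m0 : 0 < 2 ^- m :> R by exact: exp2V_gt0.
have : ratr (a m) < binsum R (b (h m)) m + 2 * 2 ^- m.
  rewrite -(ltr_pM2l (_ : 0 < 2 ^+ m))// ?exprn_gt0//.
  have mE : 2 ^+ m * (2 * 2 ^- m) = 2 :> R.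
    by rewrite mulrCA mulfV ?mulr1// expf_neq0// pnatr_eq0.
  by rewrite mulrDr mE; lra.
have : ratr (a n) <= ratr (a m) :> R by rewrite ler_rat amono.
have := ler_exp2V R nm.
have : 2 * (2 * 2 ^- n) <= 2 ^- x.+1 :> R.
  case: n xn {Nn an nm} => // -[//|n xn]; rewrite -!exp2VS; exact: ler_exp2V.
move: an l; lra.
Qed.

(** * The two sets and their intersection *)

Theorem theorem8p2 (R : realType) :
  exists A B : set nat,
    [/\ regainingly_approximable_set R A,
        regainingly_approximable_set R B
      & ~ regainingly_approximable_set R (A `&` B)].
Proof.
(* Numbers of parity other than [p] are present from the start; those of parity [p] copy half [p] of
   [C]. [A] is the case [true], [B] the case [false]. *)
pose b p s z := (odd z != p) || half_enum p s (z %/ 2)%N.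
have cb p f g : computable f -> computable g ->
    computable_bool (fun w => b p (f w) (g w)).
  move=> cf cg; rewrite /b; apply: computable_or; last by computability.
  have := computable_odd cg; case: p => co.
    by under eq_fun do rewrite eqb_id; computability.
  by under eq_fun do rewrite eqbF_neg negbK.
have bmono p s t x : (s <= t)%N -> b p s x -> b p t x.
  move=> st /orP[bx|/(half_mono st) bx]; apply/orP; [by left|by right].
have bRA p : regainingly_approximable_set R [set x | exists s, b p s x].
  apply: (regainingly_approximable_enum R (cb p) (bmono p)).
  move=> N; have [m Nm mP] := half_settled p N.+2.
  exists m; first by lia.
  move=> s x xm /orP[bx|hx]; apply/orP; [by left|right].
  by apply: mP hx; lia.
exists [set x | exists s, b true s x], [set x | exists s, b false s x].
split=> // -[_].
pose d s x := b true s x && b false s x.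
have -> : [set x | exists s, b true s x] `&` [set x | exists s, b false s x] =
    [set x | exists s, d s x].
  apply/seteqP; split=> x /= [].
    move=> [s bs] [t bt]; exists (maxn s t); rewrite /d.
    rewrite (bmono _ _ _ _ (leq_maxl _ _) bs).
    by rewrite (bmono _ _ _ _ (leq_maxr _ _) bt).
  by move=> s /andP[bs bt]; split; exists s.
move=> /regainingly_approximable_settle[|s t x st /andP[bs bt]|h ch hP].
- move=> f g cf cg; exact: computable_and (cb _ _ _ cf cg) (cb _ _ _ cf cg).
- by apply/andP; split; [exact: bmono st bs|exact: bmono st bt].
have [e eP] := computable_event_delay (computable_comp ch (computable_add
  (computable_mul (computable_const 6) computable_id) (computable_const 20))).
(* The lower bound on [n] ensures that [(n - 4) %/ 2 - e] is at least [e * e], whence [e <= r]. Then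
   [r * r + e] is the largest number of this form not exceeding [(n - 4) %/ 2]. *)
have [n nlarge nP] := hP (2 * (e * e + e) + 4)%N.
pose r := nsqrt ((n - 4) %/ 2 - e).
have /andP[r1 r2] := nsqrtP ((n - 4) %/ 2 - e); rewrite -/r in r1 r2.
have er : (e <= r)%N.
  by rewrite leqNgt; apply/negP => re; have := leq_mul re re; lia.
pose x := (r * r + e)%N.
have [[t et tx] fx] := eP x (nfst_sqr er).
(* The element of the intersection contributed by [x]: its parity is the half that [x] joins, so it
   appears only once [x] has entered. *)
pose z := (side t + 2 * x)%N.
have oz : odd z = side t by rewrite oddD oddM /= addbF; case: side.
have z2 : (z %/ 2)%N = x by rewrite /z; case: side; lia.
have dz : d t.+1 z.
  have ht : half_enum (side t) t.+1 x.
    by apply/has_iotaP; exists t => //; rewrite et tx !eqxx.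
  by rewrite /d /b oz z2; case: (side t) ht => /= ->; rewrite ?orbT.
have zn : (z.+3 <= n)%N by rewrite /z /x; case: side; lia.
(* Maximality of [r] gives [n <= 2 * x + 4 * r + 5], and [r <= r * r <= x]. *)
have nm : (n <= 6 * x + 20)%N.
  have : (r <= r * r)%N by case: (r) => // k; rewrite leq_pmulr.
  by move: r2; rewrite /x mulSn mulnS; lia.
have := nP _ _ _ nm zn dz.
rewrite /d /b oz z2 => H.
have : half_enum (side t) (h (6 * x + 20)%N) x by case: (side t) H => /andP[].
(* Presence at stage [h (6 * x + 20)] means entry strictly before it, against the delay built into
   [e]. *)
move=> /has_iotaP[u uh /and3P[eu _ /eqP ux]].
by have := fx u eu ux; rewrite leqNgt uh.
Qed.
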